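(* Consider the uniformly completely observable, perfect-model, linear, non-autonomous system $\mathbf{x}_{n+1}=A_{n+1}\mathbf{x}_n$, $\mathbf{y}_{n+1}=H_{n+1}\mathbf{x}_{n+1}+\mathbf{q}_{n+1}$ ($n\ge 0$), where the initial state $\mathbf{x}_0\in\mathbb{R}^d$ has a Gaussian law with covariance $\Delta_0>0$. Let $\Sigma_n$ and $\Delta_n$ be the Kalman filter forecast and analysis error covariance matrices, and let $d-d_0$ be the number of negative Lyapunov exponents of the system. Then for every $\epsilon>0$ there exists $n_1>0$ such that for all $n\ge n_1$, $\Sigma_n$ and $\Delta_n$ each have at least $d-d_0$ eigenvalues which are less than $\epsilon$, i.e. $$\dim\left(\mathcal{E}^{\epsilon}(\Sigma_n)\right)\ge d-d_0\quad\text{and}\quad \dim\left(\mathcal{E}^{\epsilon}(\Delta_n)\right)\ge d-d_0 .$$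
   Context: System: $\mathbf{x}_n\in\mathbb{R}^d$, $\mathbf{y}_n,\mathbf{q}_n\in\mathbb{R}^q$; the variables $\mathbf{x}_0,\mathbf{q}_1,\mathbf{q}_2,\dots$ are independent Gaussian with $\mathbf{x}_0\sim\mathcal{N}(\mathbf{x}_{0\mid 0},\Delta_0)$ and $\mathbf{q}_n\sim\mathcal{N}(0,Q_n)$. There is no model noise. The real matrices $A_n$ ($d\times d$), $H_n$ ($q\times d$), $Q_n$ ($q\times q$ covariance matrix) are known; $A_n$ and $Q_n$ are nonsingular, and $\|A_n\|\le c_A$, $\|Q_n\|\le c_Q$, $\|H_n\|\le c_H$ for all $n\ge1$ with positive constants $c_A,c_Q,c_H$. The matrix norm is the largest singular value. $Z>0$ means symmetric positive definite. Propagator: $B_{m:m+n}=A_{m+n}A_{m+n-1}\cdots A_{m+1}$, with $B_{m:m}=I$. Kalman filter recursion for $n\ge1$, started at $\Delta_0$: $\Sigma_n=A_n\Delta_{n-1}A_n^T$, $K_n=\Sigma_nH_n^T\left[H_n\Sigma_nH_n^T+Q_n\right]^{-1}$, $\Delta_n=(I-K_nH_n)\Sigma_n$. Uniform complete observability: $\det\left(\sum_{m=0}^{d-1}(B_{n:n+m})^TH_{n+m}^TQ_{n+m}^{-1}H_{n+m}B_{n:n+m}\right)$ is nonzero for all $n\ge1$ and bounded away from zero uniformly in $n$. Lyapunov exponents: the limit $E^f(0)=\lim_{n\to\infty}\left[(B_{0:n})^TB_{0:n}\right]^{1/(2n)}$ is taken to exist (conclusion of Oseledets' theorem). With its eigenvalues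 ordered $\lambda_1\ge\cdots\ge\lambda_d$, the Lyapunov exponents are $\mu_j=\log\lambda_j$, so $\mu_1\ge\cdots\ge\mu_d$ counted with multiplicity; for nonzero $\mathbf{u}$ the limits $\lim_n\frac1n\log(\|B_{0:n}\mathbf{u}\|/\|\mathbf{u}\|)$ exist and take values among the $\mu_j$. It is assumed that exactly $d_0<d$ of the $\mu_j$ are non-negative, i.e. $\mu_{d_0+1}<0$. $\alpha$-eigenspace: the real span of a complex vector $\mathbf{u}+i\mathbf{v}$ ($\mathbf{u},\mathbf{v}\in\mathbb{R}^d$) is $\{\alpha\mathbf{u}+\beta\mathbf{v}:\alpha,\beta\in\mathbb{R}\}$. For $\alpha>0$ and a square matrix $Z$, $\mathcal{E}^\alpha(Z)$ is the real span of the generalized eigenvectors of $Z$ corresponding to eigenvalues $\lambda$ with $|\lambda|<\alpha$. *)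

(* Defs.v *)
From HB Require Import structures.
From mathcomp Require Import all_boot all_order all_algebra.
From mathcomp Require Import all_classical all_reals all_analysis.
From mathcomp Require Import complex.

Set Implicit Arguments.
Unset Strict Implicit.
Unset Printing Implicit Defensive.

Import Order.TTheory GRing.Theory Num.Theory.
Import numFieldNormedType.Exports.

Local Open Scope classical_set_scope.
Local Open Scope ring_scope.

Section Matrices.
Context {R : realType}.
Implicit Types d : nat.

(* The library norm `|u| on vectors and matrices is the max norm. *)
Definition enorm d (u : 'cV[R]_d) : R := Num.sqrt (\sum_i u i 0 ^+ 2).

Definition singular_value m d (M : 'M[R]_(m, d)) (s : R) : Prop :=
  0 <= s /\ eigenvalue (M^T *m M) (s ^+ 2).

(* The set of singular values is finite, and nonempty when 0 < d. *)
Definition opnorm m d (M : 'M[R]_(m, d)) : R :=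
  sup [set s | singular_value M s].

Definition posdef d (Z : 'M[R]_d) : Prop :=
  Z^T = Z /\ forall u : 'cV[R]_d, u != 0 -> 0 < (u^T *m Z *m u) 0 0.

Definition possemidef d (Z : 'M[R]_d) : Prop :=
  Z^T = Z /\ forall u : 'cV[R]_d, 0 <= (u^T *m Z *m u) 0 0.

(* W is the matrix Z^(1/k); for 0 < k, such a W is unique, and it exists as
   soon as Z is symmetric positive semidefinite. *)
Definition psd_root d (k : nat) (Z W : 'M[R]_d) : Prop :=
  possemidef W /\ W ^+ k = Z.

End Matrices.

Section AlphaEigenspace.

(* The linear span of a possibly infinite set of vectors: the least subspace
   containing it (see vspanP for existence). *)
Definition vspan (K : fieldType) (vT : vectType K) (S : set vT) : {vspace vT} :=
  xget 0%VS [set U : {vspace vT} | (forall v, S v -> v \in U) /\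
    forall V : {vspace vT}, (forall v, S v -> v \in V) -> (U <= V)%VS].

Lemma vspanP (K : fieldType) (vT : vectType K) (S : set vT) :
  (forall v, S v -> v \in vspan S) /\
  forall V : {vspace vT}, (forall v, S v -> v \in V) -> (vspan S <= V)%VS.
Proof.
pose ok (X : seq vT) := forall v, v \in X -> S v.
pose D k := `[< exists2 X, ok X & \dim <<X>>%VS = k >].
have D0 : exists k, D k.
  by exists (\dim <<[::] : seq vT>>%VS); apply/asboolP; exists [::].
have Dub k : D k -> (k <= \dim {:vT})%N.
  by case/asboolP => X _ <-; rewrite dimvS// subvf.
case: (ex_maxnP D0 Dub) => k /asboolP[X okX dX] kmax.
rewrite /vspan; case: xgetP => [U _ //|/(_ <<X>>%VS) []]; split.
- move=> v Sv; apply/negPn/negP => vX.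
  have okvX : ok (v :: X) by move=> w; rewrite inE => /predU1P[-> //|/okX].
  have /kmax : D (\dim <<v :: X>>%VS) by apply/asboolP; exists (v :: X).
  rewrite -dX leqNgt => /negP; apply.
  have sX : (<<X>> <= <<v :: X>>)%VS by rewrite span_cons addvSr.
  rewrite (ltn_leqif (dimv_leqif_eq sX)).
  by apply: contraNN vX => /eqP ->; rewrite memv_span// mem_head.
- by move=> V SV; apply/span_subvP => v /okX /SV.
Qed.

Context {R : realType}.

Definition gen_eigenvector d (Z : 'M[R]_d) (lam : R[i]) (w : 'cV[R[i]]_d) : Prop :=
  w != 0 /\
  exists k : nat, (map_mx (real_complex R) Z - lam%:M) ^+ k *m w = 0.

Definition real_span d (w : 'cV[R[i]]_d) : set 'cV[R]_d :=
  [set v | exists a b : R, v = a *: map_mx (@complex.Re R) w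
                             + b *: map_mx (@complex.Im R) w].

Definition alpha_eigenspace d (alpha : R) (Z : 'M[R]_d) : {vspace 'cV[R]_d} :=
  vspan [set v | exists (lam : R[i]) (w : 'cV[R[i]]_d),
    [/\ `|lam| < real_complex R alpha, gen_eigenvector Z lam w & real_span w v]].

End AlphaEigenspace.

Section Probability.
Context {R : realType} {disp : measure_display} {Omega : measurableType disp}.
Variable P : probability Omega R.

(* The law N(m, C), via the laws of all linear functionals of X.  The case
   split is there because normal_prob _ 0 is not a Dirac mass. *)
Definition gaussian_vector k (X : Omega -> 'cV[R]_k) (m : 'cV[R]_k)
    (C : 'M[R]_k) : Prop :=
  (forall i, measurable_fun setT (fun w => X w i 0)) /\
  forall (u : 'cV[R]_k) (B : set R), measurable B ->
    let mean := (u^T *m m) 0 0 in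
    let var := (u^T *m C *m u) 0 0 in
    P [set w | B ((u^T *m X w) 0 0)] =
      if var == 0 then \d_mean B else normal_prob mean (Num.sqrt var) B.

Definition sigma_vector k (X : Omega -> 'cV[R]_k) : set (set Omega) :=
  <<s \bigcup_(i in [set: 'I_k])
        preimage_set_system setT (fun w => X w i 0) measurable >>.

Definition mutually_independent (G : nat -> set (set Omega)) : Prop :=
  forall (J : seq nat) (F : nat -> set Omega), uniq J ->
    (forall j, j \in J -> G j (F j)) ->
    P (\bigcap_(j in [set` J]) F j) = (\prod_(j <- J) P (F j))%E.

End Probability.

Section System.
Context {R : realType} {d q : nat}.
Variables (A : nat -> 'M[R]_d) (H : nat -> 'M[R]_(q, d)) (Q : nat -> 'M[R]_q).

(* propagator m n is B_{m:m+n}. *)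
Fixpoint propagator (m n : nat) : 'M[R]_d :=
  if n is n'.+1 then A (m + n) *m propagator m n' else 1%:M.

Definition uniformly_completely_observable : Prop :=
  exists2 c : R, 0 < c & forall n, (1 <= n)%N ->
    c <= `|\det (\sum_(m < d) (propagator n m)^T *m (H (n + m))^T
                   *m invmx (Q (n + m)) *m H (n + m) *m propagator n m)|.

Definition kalman_gain (n : nat) (S : 'M[R]_d) : 'M[R]_(d, q) :=
  S *m (H n)^T *m invmx (H n *m S *m (H n)^T + Q n).

Fixpoint kalman_analysis (D0 : 'M[R]_d) (n : nat) : 'M[R]_d :=
  if n is n'.+1 then
    let S := A n *m kalman_analysis D0 n' *m (A n)^T in
    (1%:M - kalman_gain n S *m H n) *m S
  else D0.

(* Meaningful for 1 <= n only. *)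
Definition kalman_forecast (D0 : 'M[R]_d) (n : nat) : 'M[R]_d :=
  A n *m kalman_analysis D0 n.-1 *m (A n)^T.

(* E is the limit of [(B_{0:n})^T B_{0:n}]^(1/(2n)). *)
Definition oseledets_limit (E : 'M[R]_d) : Prop :=
  exists2 W : nat -> 'M[R]_d,
    (forall n, (1 <= n)%N ->
       psd_root (2 * n) ((propagator 0 n)^T *m propagator 0 n) (W n)) &
    W n @[n --> \oo] --> E.

Definition ordered_eigenvalues (E : 'M[R]_d) (lam : 'I_d -> R) : Prop :=
  char_poly E = \prod_(j < d) ('X - (lam j)%:P) /\
  forall i j : 'I_d, (i <= j)%N -> lam j <= lam i.

(* Extended logarithm: the matrices A n are invertible, but their inverses
   need not be bounded, so that lam j = 0 is possible. *)
Definition lyapunov_exponent (lam : 'I_d -> R) (j : 'I_d) : \bar R :=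
  lne (lam j)%:E.

Definition vector_growth_rates (mu : 'I_d -> \bar R) : Prop :=
  forall u : 'cV[R]_d, u != 0 -> exists j : 'I_d,
    ((n%:R)^-1 * ln (enorm (propagator 0 n *m u) / enorm u))%:E
      @[n --> \oo] --> mu j.

End System.

(* Main.v *)
(**
  Each analysis step decreases the covariance in
  the Loewner order, hence Delta_n <= Sigma_n <= B Delta_0 B^T, where B is the
  propagator B_{0:n}.  Write W_n for the 2n-th root of B^T B.  As W_n converges
  to E, which has d - d_0 eigenvalues below 1, the matrix W_n has, for n large,
  at least d - d_0 eigenvalues below a fixed b < 1; let L be the span of the
  corresponding eigenvectors.  On the image of L under B, the form of
  B Delta_0 B^T is at most c b^(2n) |.|^2 (c a bound of Delta_0), because
  |B^T B v|^2 = |W_n^(2n) v|^2 <= b^(2n) (W_n^(2n) v, v) = b^(2n) |B v|^2 on L.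
  A form which is below eps |.|^2 on a k-dimensional space has at least k
  eigenvalues below eps.
*)
Require Import Defs.
From HB Require Import structures.
From mathcomp Require Import all_boot all_order all_algebra.
From mathcomp Require Import all_classical all_reals all_analysis.
From mathcomp Require Import complex.
From mathcomp Require Import ring lra.

Set Implicit Arguments.
Unset Strict Implicit.
Unset Printing Implicit Defensive.

Import Order.TTheory GRing.Theory Num.Theory.
Import numFieldNormedType.Exports.

Local Open Scope classical_set_scope.
Local Open Scope ring_scope.

(** * Quadratic forms of real matrices *)

Section QuadraticForms.
Context {R : realType}.

Definition qform d (S : 'M[R]_d) (u : 'cV[R]_d) : R := (u^T *m S *m u) 0 0.

Lemma qform_mul d k (S : 'M[R]_d) (M : 'M[R]_(d, k)) (u : 'cV[R]_k) :
  qform S (M *m u) = qform (M^T *m S *m M) u.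
Proof. by rewrite /qform trmx_mul !mulmxA. Qed.

Lemma qformD d (S T : 'M[R]_d) u : qform (S + T) u = qform S u + qform T u.
Proof. by rewrite /qform mulmxDr mulmxDl mxE. Qed.

Lemma qformB d (S T : 'M[R]_d) u : qform (S - T) u = qform S u - qform T u.
Proof. by rewrite /qform mulmxBr mulmxBl !mxE. Qed.

Lemma qform_sum d (S : 'M[R]_d) u :
  qform S u = \sum_i \sum_j u i 0 * S i j * u j 0.
Proof.
rewrite /qform mxE exchange_big; apply: eq_bigr => j _.
by rewrite mxE mulr_suml; apply: eq_bigr => i _; rewrite mxE.
Qed.

Lemma qform_diag d (D : 'rV[R]_d) u :
  qform (diag_mx D) u = \sum_i D 0 i * u i 0 ^+ 2.
Proof.
rewrite /qform mxE; apply: eq_bigr => i _.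
by rewrite mul_mx_diag !mxE mulrAC mulrC expr2.
Qed.

Lemma qform1 d (u : 'cV[R]_d) : qform 1%:M u = \sum_i u i 0 ^+ 2.
Proof.
by rewrite /qform mulmx1 mxE; apply: eq_bigr => i _; rewrite mxE expr2.
Qed.

Lemma qform1_ge0 d (u : 'cV[R]_d) : 0 <= qform 1%:M u.
Proof. by rewrite qform1 sumr_ge0// => i _; rewrite sqr_ge0. Qed.

Lemma qform1_gt0 d (u : 'cV[R]_d) : u != 0 -> 0 < qform 1%:M u.
Proof.
move=> u0; rewrite lt_neqAle qform1_ge0 andbT eq_sym.
apply: contra_neq u0 => /eqP; rewrite qform1 psumr_eq0; last first.
  by move=> i _; rewrite sqr_ge0.
move=> /allP u0; apply/matrixP => i j; rewrite ord1 mxE.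
by have := u0 i; rewrite mem_index_enum sqrf_eq0 => /(_ isT)/eqP.
Qed.

Lemma qform_entries_le d (S : 'M[R]_d) (a : R) (u : 'cV[R]_d) :
  (forall i j, `|S i j| <= a) -> qform S u <= a * d%:R * qform 1%:M u.
Proof.
move=> Sa; rewrite qform_sum.
apply: (@le_trans _ _ (\sum_i \sum_j a * (u i 0 ^+ 2 + u j 0 ^+ 2) / 2)).
  apply: ler_sum => i _; apply: ler_sum => j _.
  rewrite (le_trans (ler_norm _))// !normrM.
  rewrite -[u i 0 ^+ 2]real_normK ?num_real//.
  rewrite -[u j 0 ^+ 2]real_normK ?num_real//.
  have := Sa i j; have := normr_ge0 (S i j).
  move: `|u i 0| `|u j 0| `|S i j| => x y s s0 sa.
  (* This quantity equals [a * (x ^+ 2 + y ^+ 2) - 2 * s * x * y]; its sign is the termwise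
     arithmetic-geometric bound. *)
  have : 0 <= (a - s) * (x ^+ 2 + y ^+ 2) + s * (x - y) ^+ 2.
    by rewrite addr_ge0// mulr_ge0 ?subr_ge0 ?addr_ge0 ?sqr_ge0.
  nra.
rewrite le_eqVlt; apply/orP; left; apply/eqP.
under eq_bigr do rewrite -mulr_suml -mulr_sumr big_split/= sumr_const card_ord.
rewrite -mulr_suml -mulr_sumr big_split/= sumr_const card_ord.
rewrite sumrMnl -qform1 -mulr_natr.
by field.
Qed.

Lemma posdef_unit d (S : 'M[R]_d) : posdef S -> S \in unitmx.
Proof.
move=> [St S0]; rewrite -row_free_unit -kermx_eq0; apply/eqP/row_matrixP => i.
rewrite row0; apply/eqP/negPn/negP => v0.
have /S0 : (row i (kermx S))^T != 0 by rewrite -(inj_eq trmx_inj) trmxK trmx0.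
by rewrite trmxK -row_mul mulmx_ker row0 mul0mx mxE ltxx.
Qed.

End QuadraticForms.

(** * Real spectral theorem and counting of small eigenvalues *)

Section Spectral.
Context {R : realType}.

(** Over the complex numbers [S] is hermitian, hence unitarily diagonalizable with real eigenvalues.
    A real eigenvalue of the complexified matrix is already an eigenvalue over [R], which gives a
    real eigenvector to normalize. *)
Lemma symmetric_eigenvector n (S : 'M[R]_n.+1) : S^T = S ->
  exists v : 'rV[R]_n.+1, exists a, (v *m v^T) 0 0 = 1 /\ v *m S = a *: v.
Proof.
move=> St.
pose SC := map_mx (real_complex R) S.
have SCr : SC \is a mxOver Num.real.
  by apply/mxOverP => i j; rewrite mxE /= complex_real.
have SCs : SC \is symmetricmx.
  by apply/is_hermitianmxP; rewrite scale1r map_mx_id// /SC map_trmx St.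
have SCh := realsym_hermsym SCs SCr.
have /orthomx_spectralP SCE := hermitian_normalmx SCh.
have Xr := hermitian_spectral_diag_real SCh.
have Qu := spectral_unit SC.
set X := spectral_diag SC in SCE Xr; set Q := spectralmx SC in SCE Qu.
have [a aX] : exists a, X 0 0 = real_complex R a.
  by apply/complex_realP; move/mxOverP : Xr; exact.
have : eigenvalue SC (X 0 0).
  apply/eigenvalueP; exists (row 0 Q).
    rewrite SCE !mulmxA -row_mul mulmxV// row1 -rowE row_diag_mx.
    by rewrite -scalemxAl -rowE.
  apply/eqP => Q0; have : row 0 (Q *m invmx Q) = 0 by rewrite row_mul Q0 mul0mx.
  rewrite mulmxV// => /rowP/(_ 0); rewrite !mxE eqxx => /eqP.
  by rewrite oner_eq0.
rewrite aX eigenvalue_map => /eigenvalueP[w wS w0].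
have ww : 0 < (w *m w^T) 0 0.
  have : w^T != 0 by rewrite -(inj_eq trmx_inj) trmxK trmx0.
  by move/qform1_gt0; rewrite /qform mulmx1 trmxK.
exists ((Num.sqrt ((w *m w^T) 0 0))^-1 *: w), a; split.
  rewrite linearZ/= -scalemxAl -scalemxAr scalerA mxE -invfM -expr2.
  by rewrite sqr_sqrtr ?ltW// mulVf// gt_eqF.
by rewrite -scalemxAl wS !scalerA mulrC.
Qed.

(** Take the reflection in the hyperplane orthogonal to [v - w]; it exchanges two vectors of equal
    length. *)
Lemma householder_reflection n (v w : 'rV[R]_n) : (v *m v^T) 0 0 = (w *m w^T) 0 0 ->
  exists U : 'M[R]_n, [/\ U^T = U, U *m U = 1%:M & v *m U = w].
Proof.
move=> vw; have [->|nvw] := eqVneq v w.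
  by exists 1%:M; rewrite trmx1 !mulmx1.
have [z zE] : exists z, z = v - w by exists (v - w).
pose c := (z *m z^T) 0 0.
have zz : z *m z^T = c%:M by rewrite [LHS]mx11_scalar.
have c0 : c != 0.
  have : z^T != 0 by rewrite -(inj_eq trmx_inj) trmxK trmx0 zE subr_eq0.
  by move/qform1_gt0; rewrite /qform mulmx1 trmxK => /gt_eqF ->.
exists (1%:M - (2 / c) *: (z^T *m z)); split.
- by rewrite linearB/= trmx1 linearZ/= trmx_mul trmxK.
- have GG : (z^T *m z) *m (z^T *m z) = c *: (z^T *m z).
    by rewrite mulmxA -(mulmxA z^T z) zz mul_mx_scalar -scalemxAl.
  rewrite mulmxDl mul1mx mulmxDr mulmx1 !(mulNmx, mulmxN) opprK.
  rewrite -scalemxAl -scalemxAr GG !scalerA.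
  have -> : 2 / c * (2 / c) * c = 2 / c + 2 / c by field.
  by rewrite scalerDl addKr subrK.
(* Equal lengths enter here: the product of [v] with [v - w] is half the squared length of
   [v - w]. *)
have vz : v *m z^T = (c / 2)%:M.
  rewrite [LHS]mx11_scalar; congr _%:M; rewrite /c zE.
  have wv : (w *m v^T) 0 0 = (v *m w^T) 0 0.
    by rewrite -[w *m _]trmxK trmx_mul trmxK mxE.
  rewrite linearB/= mulmxBl !mulmxDr !mulmxN.
  move: vw wv; rewrite !mxE => -> ->; by field.
rewrite mulmxBr mulmx1 -scalemxAr mulmxA vz mul_scalar_mx scalerA.
have -> : 2 / c * (c / 2) = 1 by field.
by rewrite scale1r zE opprB addrC subrK.
Qed.

Definition spectral_decomp n (S P : 'M[R]_n) (D : 'rV[R]_n) :=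
  P *m P^T = 1%:M /\ S = P^T *m diag_mx D *m P.

(** Induction on the size: a reflection moves a unit eigenvector to the first basis vector. By
    symmetry, the conjugate of [S] is then block diagonal with a block of size 1, and the induction
    hypothesis diagonalizes the other block. *)
Lemma real_spectral n (S : 'M[R]_n) : S^T = S ->
  exists P D, spectral_decomp S P D.
Proof.
elim: n S => [|n IHn] S St.
  by exists 1%:M, 0; split; apply/matrixP => -[].
have [v [a [vv vS]]] := symmetric_eigenvector St.
pose e : 'rV[R]_n.+1 := delta_mx 0 0.
have ee : (e *m e^T) 0 0 = 1 by rewrite -rowE !mxE !eqxx.
have [U [Ut UU vU]] := householder_reflection (etrans vv (esym ee)).
have eU : e *m U = v by rewrite -vU -mulmxA UU mulmx1.
have [T defT] : exists T : 'M[R]_(1 + n), T = U *m S *m U.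
  by exists (U *m S *m U).
have Tt : T^T = T by rewrite defT !trmx_mul Ut St mulmxA.
have eT : row 0 T = a *: e by rewrite rowE defT !mulmxA eU vS -scalemxAl vU.
have T0 : ursubmx T = 0.
  apply/rowP => j; have /rowP/(_ (rshift 1 j)) := eT.
  by rewrite !mxE /= mulr0 => <-; congr (T _ _); apply/val_inj.
have T0' : dlsubmx T = 0 by rewrite -[LHS]trmxK trmx_dlsub Tt T0 trmx0.
have T1 : ulsubmx T = a%:M.
  apply/rowP => j; have /rowP/(_ 0) := eT; rewrite !ord1 !mxE !eqxx mulr1 => <-.
  by congr (T _ _); apply/val_inj.
have /IHn[P [D [PP TE]]] : (drsubmx T)^T = drsubmx T by rewrite trmx_drsub Tt.
pose V : 'M[R]_(1 + n) := block_mx 1%:M 0 0 P.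
have VV : V *m V^T = 1%:M.
  rewrite /V tr_block_mx mulmx_block !trmx0 trmx1 !mulmx0 !mul0mx PP.
  by rewrite !mulmx1 !addr0 add0r -scalar_mx_block.
have TV : T = V^T *m diag_mx (row_mx a%:M D) *m V.
  rewrite -[LHS]submxK T0 T0' T1 TE diag_mx_row /V tr_block_mx !mulmx_block.
  rewrite !trmx0 trmx1 !(mulmx0, mul0mx, addr0, add0r, mul1mx, mulmx1).
  congr block_mx; apply/matrixP => i j; rewrite !mxE !ord1.
  by rewrite !mulr1n.
exists (V *m U), (row_mx a%:M D); split.
  by rewrite trmx_mul Ut !mulmxA -(mulmxA V) UU mulmx1.
rewrite trmx_mul Ut !mulmxA.
rewrite -(mulmxA U) -(mulmxA U) -TV defT !mulmxA UU mul1mx -mulmxA UU mulmx1.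
by [].
Qed.

(* The eigenvectors of P^T *m diag_mx D *m P are the rows of P. *)
Definition low_eigenbasis n (P : 'M[R]_n) (D : 'rV[R]_n) (a : R) :
    'M[R]_(n, #|[pred i | D 0 i < a]|) :=
  (rowsub (fun j : 'I_#|[pred i | D 0 i < a]| => enum_val j) P)^T.

Lemma low_eigenbasis_ortho n (P : 'M[R]_n) (D : 'rV[R]_n) (a : R) :
  P *m P^T = 1%:M -> (low_eigenbasis P D a)^T *m low_eigenbasis P D a = 1%:M.
Proof.
move=> PP; apply/matrixP => i j.
have /matrixP/(_ (enum_val i) (enum_val j)) := PP.
rewrite !mxE (inj_eq enum_val_inj) => <-.
by apply: eq_bigr => k _; rewrite !mxE.
Qed.

Lemma low_eigenbasis_high n (P : 'M[R]_n) (D : 'rV[R]_n) (a : R)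
    (u : 'cV[R]_#|[pred i | D 0 i < a]|) i :
  P *m P^T = 1%:M -> a <= D 0 i -> (P *m (low_eigenbasis P D a *m u)) i 0 = 0.
Proof.
move=> PP aD; rewrite mulmxA mxE big1// => j _.
have -> : (P *m low_eigenbasis P D a) i j = (P *m P^T) i (enum_val j).
  by rewrite !mxE; apply: eq_bigr => k _; rewrite !mxE.
rewrite PP mxE; case: eqVneq => [iE|]; last by rewrite mul0r.
by have := enum_valP j; rewrite -iE inE ltNge aD.
Qed.

Lemma low_eigenbasis_qform n (P : 'M[R]_n) (D : 'rV[R]_n) (a : R)
    (u : 'cV[R]_#|[pred i | D 0 i < a]|) :
  P *m P^T = 1%:M ->
  qform 1%:M (low_eigenbasis P D a *m u) = qform 1%:M u.
Proof. by move=> PP; rewrite qform_mul mulmx1 low_eigenbasis_ortho. Qed.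

Lemma spectral_qform n (S P : 'M[R]_n) D v : spectral_decomp S P D ->
  qform S v = \sum_i D 0 i * (P *m v) i 0 ^+ 2.
Proof. by move=> [PP ->]; rewrite -qform_diag qform_mul. Qed.

Lemma spectral_qform1 n (S P : 'M[R]_n) D v : spectral_decomp S P D ->
  qform 1%:M v = \sum_i (P *m v) i 0 ^+ 2.
Proof.
move=> [PP _]; rewrite -qform1 qform_mul mulmx1.
by have /mulmx1C -> := PP.
Qed.

(** The dimension count of the Courant-Fischer principle: with fewer than [k] eigenvalues below [a],
    some nonzero [u] would have [M *m u] orthogonal to all their eigenvectors, and there the form is
    at least [a] times the squared norm. Injectivity of [M] is implicit in the strict inequality. *)
Lemma rayleigh_count n k (S P : 'M[R]_n) D (M : 'M[R]_(n, k)) (a : R) :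
  spectral_decomp S P D ->
  (forall u, u != 0 -> qform S (M *m u) < a * qform 1%:M (M *m u)) ->
  (k <= #|[pred i | (D 0 i < a)%R]|)%N.
Proof.
move=> SD MS; rewrite leqNgt; apply/negP => lt_k.
pose N := (low_eigenbasis P D a)^T *m M.
have : kermx N^T != 0.
  rewrite -mxrank_eq0 mxrank_ker mxrank_tr subn_eq0 -ltnNge.
  by rewrite (leq_ltn_trans (rank_leq_row N)).
move=> /rowV0Pn[w /sub_kermxP wN w0].
have uN : N *m w^T = 0 by rewrite -[LHS]trmxK trmx_mul trmxK wN trmx0.
have /MS : w^T != 0 by rewrite -(inj_eq trmx_inj) trmxK trmx0.
rewrite ltNge => /negP; apply.
rewrite (spectral_qform _ SD) (spectral_qform1 _ SD) mulr_sumr.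
apply: ler_sum => i _; have [Da|aD] := ltP (D 0 i) a; last first.
  by rewrite ler_wpM2r ?sqr_ge0.
suff -> : (P *m (M *m w^T)) i 0 = 0 by rewrite expr0n !mulr0.
have iJ : i \in [pred i | D 0 i < a] by rewrite inE.
have /matrixP/(_ (enum_rank_in iJ i) 0) := uN.
rewrite /N -mulmxA mxE [RHS]mxE => uNi; rewrite -[RHS]uNi mxE.
by apply: eq_bigr => j _; rewrite !mxE enum_rankK_in.
Qed.

Lemma spectral_exp n (S P : 'M[R]_n) D k : spectral_decomp S P D ->
  spectral_decomp (S ^+ k) P (\row_i D 0 i ^+ k).
Proof.
move=> [PP SE]; split=> //; elim: k => [|k IHk].
  rewrite expr0; have -> : diag_mx (\row_i D 0 i ^+ 0) = 1%:M.
    by apply/matrixP => i j; rewrite !mxE expr0.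
  by rewrite mulmx1; have /mulmx1C -> := PP.
rewrite exprS IHk SE -[LHS]/(_ *m _) !mulmxA -(mulmxA _ P P^T) PP mulmx1.
rewrite -(mulmxA P^T) mulmx_diag; congr (_ *m diag_mx _ *m _).
by apply/rowP => i; rewrite !mxE exprS.
Qed.

Lemma possemidef_spectral_ge0 n (S P : 'M[R]_n) D i :
  possemidef S -> spectral_decomp S P D -> 0 <= D 0 i.
Proof.
move=> [_ S0] SD; have := S0 (P^T *m delta_mx i 0).
have [PP _] := SD.
rewrite -/(qform _ _) (spectral_qform _ SD) mulmxA PP mul1mx.
rewrite (bigD1 i)//= big1 ?addr0; last first.
  by move=> j ji; rewrite mxE (negPf ji) expr0n mulr0.
by rewrite mxE !eqxx expr1n mulr1.
Qed.

(** The low eigenvectors are orthonormal, hence free, and each is its own real span.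
    Semidefiniteness turns [D 0 i < a] into the bound on the modulus of the eigenvalue. *)
Lemma alpha_eigenspace_ge n (S P : 'M[R]_n) D (a : R) :
  possemidef S -> spectral_decomp S P D ->
  (#|[pred i | (D 0 i < a)%R]| <= \dim (alpha_eigenspace a S))%N.
Proof.
move=> Spsd SD; have [PP SE] := SD.
pose L := low_eigenbasis P D a.
pose X := [tuple col j L | j < #|[pred i | D 0 i < a]|].
have freeX : free X.
  apply/freeP => c; under eq_bigr do rewrite nth_mktuple.
  (* Multiplying by [L^T] recovers the coefficients, the columns of [L] being orthonormal. *)
  move=> cL j; have : L^T *m (L *m (\col_j c j)) = 0.
    rewrite [L *m _](_ : _ = 0) ?mulmx0// -cL.
    apply/colP => i; rewrite mxE summxE; apply: eq_bigr => k _.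
    by rewrite !mxE mulrC.
  by rewrite mulmxA low_eigenbasis_ortho// mul1mx => /colP/(_ j); rewrite !mxE.
have [vsub _] := vspanP [set v | exists (lam : R[i]) (w : 'cV[R[i]]_n),
    [/\ `|lam| < real_complex R a, gen_eigenvector S lam w & real_span w v]].
suff : (<<X>> <= alpha_eigenspace a S)%VS.
  by move=> /dimvS; rewrite (eqnP freeX) size_tuple.
apply/span_subvP => v /mapP[j _ ->]; apply: vsub.
have Da : D 0 (enum_val j) < a by have := enum_valP j; rewrite inE.
exists (real_complex R (D 0 (enum_val j))), (map_mx (real_complex R) (col j L)).
split.
- rewrite normc_def /= expr0n addr0 sqrtr_sqr ltcR ger0_norm//.
  exact: possemidef_spectral_ge0 Spsd SD.
- split.
    rewrite map_mx_eq0; apply/eqP => L0.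
    have := low_eigenbasis_ortho D a PP; rewrite -/L => /matrixP/(_ j j).
    rewrite !mxE eqxx => /eqP; rewrite big1 ?(eq_sym 0) ?oner_eq0//.
    by move=> i _; move/colP/(_ i) : L0; rewrite !mxE => ->; rewrite mulr0.
  exists 1%N; rewrite expr1 -map_scalar_mx -map_mxB -map_mxM.
  suff -> : (S - (D 0 (enum_val j))%:M) *m col j L = 0 by rewrite map_mx0.
  have -> : col j L = P^T *m delta_mx (enum_val j) 0.
    by rewrite -colE; apply/colP => i; rewrite !mxE.
  rewrite mulmxBl mul_scalar_mx SE -!mulmxA (mulmxA P) PP mul1mx.
  rewrite mul_diag_mx; apply/eqP; rewrite subr_eq0; apply/eqP.
  rewrite scalemxAr; congr (_ *m _); apply/colP => i; rewrite !mxE.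
  by case: eqVneq => [->|]; rewrite ?mulr0.
- exists 1, 0; rewrite scale1r scale0r addr0.
  by apply/colP => i; rewrite !mxE.
Qed.

Lemma low_eigenspace_growth n (S P B G : 'M[R]_n) (D : 'rV[R]_n) (a c : R)
    (k : nat) :
  spectral_decomp S P D -> possemidef S -> S ^+ (2 * k) = B^T *m B ->
  0 <= c -> (forall v, qform G v <= c * qform 1%:M v) ->
  forall u, qform (B *m G *m B^T) (B *m (low_eigenbasis P D a *m u)) <=
    c * a ^+ (2 * k) * qform 1%:M (B *m (low_eigenbasis P D a *m u)).
Proof.
move=> SD Spsd SB c0 Gc u; have [PP _] := SD.
set v := low_eigenbasis P D a *m u.
have -> : qform 1%:M (B *m v) = qform (S ^+ (2 * k)) v.
  by rewrite qform_mul mulmx1 SB.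
have -> : qform (B *m G *m B^T) (B *m v) = qform G (S ^+ (2 * k) *m v).
  by rewrite SB -mulmxA [RHS]qform_mul trmx_mul trmxK qform_mul !mulmxA.
apply: (le_trans (Gc _)); rewrite -mulrA ler_wpM2l//.
have SDk := spectral_exp (2 * k) SD.
rewrite (spectral_qform1 _ SD) (spectral_qform _ SDk) mulr_sumr.
apply: ler_sum => i _.
have -> : (P *m (S ^+ (2 * k) *m v)) i 0 = D 0 i ^+ (2 * k) * (P *m v) i 0.
  have [_ ->] := SDk; rewrite -!mulmxA (mulmxA P) PP mul1mx mul_diag_mx.
  by rewrite !mxE.
(* Coordinates along high eigenvectors vanish; along a low one, one factor [D 0 i ^+ (2 * k)] out of
   two is replaced by [a ^+ (2 * k)]. *)
have [aD|Da] := leP a (D 0 i).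
  by rewrite /v low_eigenbasis_high// mulr0 expr0n !mulr0.
have D0 := possemidef_spectral_ge0 i Spsd SD.
rewrite exprMn mulrA [X in X <= _]mulrC [X in _ <= X]mulrC.
rewrite ler_wpM2l ?sqr_ge0// mxE expr2 ler_wpM2r ?exprn_ge0//.
by rewrite lerXn2r// ?nnegrE// ltW// (le_lt_trans D0).
Qed.

End Spectral.

(** * Positive semidefinite matrices *)

Section Semidefinite.
Context {R : realType}.

(** In eigencoordinates a zero value of the form is a vanishing sum of nonnegative terms, which
    forces [Z *m u = 0]. *)
Lemma possemidef_unit_posdef k (Z : 'M[R]_k) :
  possemidef Z -> Z \in unitmx -> posdef Z.
Proof.
move=> Zpsd Zu; have [Zt Z0] := Zpsd; split=> // u u0.
rewrite lt_neqAle Z0 andbT eq_sym; apply: contra_neq u0.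
have [P [D SD]] := real_spectral Zt; have [PP ZE] := SD.
have D0 i := possemidef_spectral_ge0 i Zpsd SD.
rewrite -/(qform _ _) (spectral_qform _ SD) => /eqP.
rewrite psumr_eq0; last by move=> i _; rewrite mulr_ge0 ?sqr_ge0.
move=> /allP Du.
suff Zu0 : Z *m u = 0 by rewrite -[u](mulKmx Zu) Zu0 mulmx0.
rewrite ZE -!mulmxA mul_diag_mx [X in _ *m X](_ : _ = 0) ?mulmx0//.
apply/colP => i; rewrite mxE [RHS]mxE; apply/eqP.
have := Du i; rewrite mem_index_enum mulf_eq0 sqrf_eq0 => /(_ isT).
by rewrite mulf_eq0.
Qed.

Lemma possemidef_congr k l (Z : 'M[R]_k) (M : 'M[R]_(l, k)) :
  possemidef Z -> possemidef (M *m Z *m M^T).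
Proof.
move=> [Zt Z0]; split; first by rewrite !trmx_mul trmxK Zt mulmxA.
by move=> u; have := Z0 (M^T *m u); rewrite trmx_mul trmxK !mulmxA.
Qed.

Lemma possemidefD k (Y Z : 'M[R]_k) :
  possemidef Y -> possemidef Z -> possemidef (Y + Z).
Proof.
move=> [Yt Y0] [Zt Z0]; split; first by rewrite linearD/= Yt Zt.
by move=> u; rewrite -/(qform _ _) qformD addr_ge0 ?Y0 ?Z0.
Qed.

End Semidefinite.

(** * Loewner bounds for the Kalman covariances *)

Section Kalman.
Context {R : realType} {d q : nat}.
Variables (A : nat -> 'M[R]_d) (H : nat -> 'M[R]_(q, d)) (Q : nat -> 'M[R]_q).
Hypothesis Q_cov : forall n, (1 <= n)%N -> possemidef (Q n).
Hypothesis Q_unit : forall n, (1 <= n)%N -> Q n \in unitmx.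

(** Makes the [invmx] in the Kalman gain a true inverse. *)
Lemma innovation_posdef n (S : 'M[R]_d) : (1 <= n)%N -> possemidef S ->
  posdef (H n *m S *m (H n)^T + Q n).
Proof.
move=> n1 S0.
have [Zt Z0] := possemidefD (possemidef_congr (H n) S0) (Q_cov n1).
split=> // u u0; rewrite -/(qform _ _) qformD ltr_wpDl//.
  by have [_] := possemidef_congr (H n) S0; exact.
by have [_] := possemidef_unit_posdef (Q_cov n1) (Q_unit n1); exact.
Qed.

(* Joseph's form of the analysis covariance, which is visibly positive
   semidefinite. *)
Lemma joseph_form n (S : 'M[R]_d) : (1 <= n)%N -> possemidef S ->
  let K := kalman_gain H Q n S in
  (1%:M - K *m H n) *m S =
  (1%:M - K *m H n) *m S *m (1%:M - K *m H n)^T + K *m Q n *m K^T.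
Proof.
move=> n1 S0 K; set Z := H n *m S *m (H n)^T + Q n.
have KZ : K *m Z = S *m (H n)^T.
  by rewrite /K /kalman_gain mulmxKV// posdef_unit//; exact: innovation_posdef.
rewrite linearB/= trmx1 trmx_mul mulmxBr mulmx1 -addrA.
rewrite -[LHS]addr0; congr (_ + _).
(* This is [KZ] with [Z] expanded; it cancels the two terms left over from the expansion of the
   right-hand side. *)
have -> : K *m Q n = (1%:M - K *m H n) *m S *m (H n)^T.
  rewrite -[RHS]mulmxA mulmxBl mul1mx -{1}KZ /Z mulmxDr !mulmxA.
  by rewrite addrAC subrr add0r.
by rewrite mulmxA addNr.
Qed.

Lemma kalman_update n (S : 'M[R]_d) : (1 <= n)%N -> possemidef S ->
  let D := (1%:M - kalman_gain H Q n S *m H n) *m S in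
  possemidef D /\ forall v, qform D v <= qform S v.
Proof.
move=> n1 S0 D; have [St _] := S0; split.
  rewrite /D joseph_form//; apply: possemidefD; last first.
    exact: possemidef_congr (Q_cov n1).
  exact: possemidef_congr.
move=> v; rewrite /D mulmxBl mul1mx qformB gerBl /kalman_gain.
set Z := H n *m S *m (H n)^T + Q n.
have Zpd : posdef Z by exact: innovation_posdef.
have Zu := posdef_unit Zpd; have [Zt Z0] := Zpd.
(* The decrease of the form at [v] is the form of [Z] at this [w], hence nonnegative. *)
set w := invmx Z *m (H n *m S *m v).
suff -> : qform (S *m (H n)^T *m invmx Z *m H n *m S) v = qform Z w.
  by have [->|/Z0/ltW//] := eqVneq w 0; rewrite /qform mulmx0 mxE.
rewrite /qform /w; congr (_ _ 0 0).
rewrite -!mulmxA mulKVmx//; rewrite !trmx_mul trmx_inv St Zt.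
by rewrite !mulmxA.
Qed.

(** Congruence by [A n] preserves the Loewner order and each update decreases it. Semidefiniteness
    is carried through the induction because [kalman_update] requires it. *)
Lemma kalman_le n (D0 : 'M[R]_d) : possemidef D0 ->
  possemidef (kalman_analysis A H Q D0 n) /\
  forall v, qform (kalman_analysis A H Q D0 n) v <=
    qform (propagator A 0 n *m D0 *m (propagator A 0 n)^T) v.
Proof.
move=> D0psd; elim: n => [|n [IHp IHle]] /=.
  by rewrite trmx1 mul1mx mulmx1.
have [Dp Dle] := @kalman_update n.+1 _ isT (possemidef_congr (A n.+1) IHp).
split=> // v; apply: (le_trans (Dle v)).
have := IHle ((A n.+1)^T *m v).
by rewrite !qform_mul !trmxK trmx_mul !mulmxA add0n.
Qed.

Lemma kalman_forecast_le n (D0 : 'M[R]_d) : (1 <= n)%N -> possemidef D0 ->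
  possemidef (kalman_forecast A H Q D0 n) /\
  forall v, qform (kalman_forecast A H Q D0 n) v <=
    qform (propagator A 0 n *m D0 *m (propagator A 0 n)^T) v.
Proof.
case: n => // n _ D0psd; have [IHp IHle] := kalman_le n D0psd.
split; first exact: possemidef_congr.
move=> v; have := IHle ((A n.+1)^T *m v).
by rewrite /kalman_forecast /= !qform_mul !trmxK trmx_mul !mulmxA add0n.
Qed.

Lemma propagator_unit n : (forall k, (1 <= k)%N -> A k \in unitmx) ->
  propagator A 0 n \in unitmx.
Proof.
move=> Au; elim: n => [|n IHn] /=; first exact: unitmx1.
by rewrite unitmx_mul IHn andbT Au.
Qed.

End Kalman.

(** * Small eigenvalues of the Oseledets limit and of its approximations *)

Section LyapunovSpectrum.
Context {R : realType}.

(** Similar matrices share their characteristic polynomial, and unique factorization makes [lam] and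
    [D] equal up to a permutation. *)
Lemma ordered_eigenvalues_count d (S P : 'M[R]_d) D lam (a : R) :
  spectral_decomp S P D -> ordered_eigenvalues S lam ->
  #|[pred i | D 0 i < a]| = #|[pred i | lam i < a]|.
Proof.
move=> [PP SE] [Slam _].
have : char_poly S = \prod_(i < d) ('X - (D 0 i)%:P).
  have -> : char_poly S = char_poly (diag_mx D).
    rewrite /char_poly.
    have -> : char_poly_mx S = map_mx polyC P^T *m char_poly_mx (diag_mx D)
                                 *m map_mx polyC P.
      rewrite /char_poly_mx mulmxBr mulmxBl -!map_mxM -SE mul_mx_scalar.
      rewrite -scalemxAl -map_mxM (mulmx1C PP) map_mx1.
      by rewrite scalemx1.
    rewrite !det_mulmx mulrAC -det_mulmx -map_mxM (mulmx1C PP) map_mx1.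
    by rewrite det1 mul1r.
  rewrite char_poly_trig ?diag_mx_is_trig//.
  by apply: eq_bigr => i _; rewrite mxE eqxx mulr1n.
rewrite Slam => SlamD.
have /permP/(_ [pred x | x < a]) :
    perm_eq [seq lam i | i : 'I_d] [seq D 0 i | i : 'I_d].
  by apply: prod_XsubC_eq; rewrite !big_image.
rewrite !count_map !cardE /enum_mem !size_filter => /esym DE.
by etransitivity; first exact: DE.
Qed.

(** A Weyl-type bound: on the span of the low eigenvectors of [S], passing to [T] raises the form by
    at most [e * d%:R] times the squared norm, so [rayleigh_count] applies. *)
Lemma low_count_perturb d (S T P P' : 'M[R]_d) D D' (a b e : R) :
  spectral_decomp S P D -> spectral_decomp T P' D' ->
  (forall i j, `|(T - S) i j| <= e) -> a + e * d%:R < b ->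
  (#|[pred i | (D 0 i < a)%R]| <= #|[pred i | (D' 0 i < b)%R]|)%N.
Proof.
move=> SD TD TSe eb.
apply: (rayleigh_count (M := low_eigenbasis P D a) TD) => u u0.
have [PP _] := SD.
set v := low_eigenbasis P D a *m u.
have v0 : 0 < qform 1%:M v by rewrite low_eigenbasis_qform// qform1_gt0.
apply: le_lt_trans (_ : (a + e * d%:R) * qform 1%:M v < _); last first.
  by rewrite ltr_pM2r.
rewrite -[T](subrK S) qformD addrC mulrDl.
apply: lerD; last exact: qform_entries_le.
rewrite (spectral_qform _ SD) (spectral_qform1 _ SD) mulr_sumr.
apply: ler_sum => i _; have [aD|Da] := leP a (D 0 i).
  by rewrite /v low_eigenbasis_high// expr0n !mulr0.
by rewrite ler_wpM2r ?sqr_ge0// ltW.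
Qed.

Lemma alpha_eigenspace_rayleigh d k (S : 'M[R]_d) (M : 'M[R]_(d, k)) (a : R) :
  possemidef S ->
  (forall u, u != 0 -> qform S (M *m u) < a * qform 1%:M (M *m u)) ->
  (k <= \dim (alpha_eigenspace a S))%N.
Proof.
move=> Spsd MS; have [P [D SD]] := real_spectral Spsd.1.
exact: leq_trans (rayleigh_count SD MS) (alpha_eigenspace_ge a Spsd SD).
Qed.

Lemma low_gap d (D : 'rV[R]_d) : exists a : R, [/\ 0 < a, a < 1 &
  #|[pred i | D 0 i < a]| = #|[pred i | D 0 i < 1]| ].
Proof.
(* Starting the maximum at 0 keeps the midpoint of [m] and 1 positive, even if no entry is below
   1. *)
pose m := \big[Order.max/0]_(i | D 0 i < 1) D 0 i.
have m1 : m < 1 by apply/bigmax_ltP; split.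
have m0 : 0 <= m by exact: bigmax_ge_id.
exists ((1 + m) / 2); split; [lra|lra|].
apply: eq_card => i; rewrite !inE; apply/idP/idP => [|Di]; first lra.
have : D 0 i <= m by exact: le_bigmax_cond.
lra.
Qed.

End LyapunovSpectrum.

(** * Asymptotic rank deficiency of the error covariances *)

Theorem theorem3p5 (R : realType) (d q : nat)
  (disp : measure_display) (Omega : measurableType disp)
  (P : probability Omega R)
  (A : nat -> 'M[R]_d) (H : nat -> 'M[R]_(q, d)) (Q : nat -> 'M[R]_q)
  (x : nat -> Omega -> 'cV[R]_d) (y noise : nat -> Omega -> 'cV[R]_q)
  (m0 : 'cV[R]_d) (Delta0 : 'M[R]_d)
  (cA cQ cH : R)
  (E : 'M[R]_d) (lam : 'I_d -> R) (d0 : nat)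
  (A_unit : forall n, (1 <= n)%N -> A n \in unitmx)
  (Q_cov : forall n, (1 <= n)%N -> possemidef (Q n))
  (Q_unit : forall n, (1 <= n)%N -> Q n \in unitmx)
  (cA_gt0 : 0 < cA) (cQ_gt0 : 0 < cQ) (cH_gt0 : 0 < cH)
  (A_le : forall n, (1 <= n)%N -> opnorm (A n) <= cA)
  (Q_le : forall n, (1 <= n)%N -> opnorm (Q n) <= cQ)
  (H_le : forall n, (1 <= n)%N -> opnorm (H n) <= cH)
  (Delta0_gt0 : posdef Delta0)
  (x0_law : gaussian_vector P (x 0%N) m0 Delta0)
  (noise_law : forall n, (1 <= n)%N -> gaussian_vector P (noise n) 0 (Q n))
  (indep : mutually_independent P (fun n =>
     if n is 0%N then sigma_vector (x 0%N) else sigma_vector (noise n)))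
  (x_dyn : forall n w, x n.+1 w = A n.+1 *m x n w)
  (y_obs : forall n w, y n.+1 w = H n.+1 *m x n.+1 w + noise n.+1 w)
  (obs : uniformly_completely_observable A H Q)
  (E_lim : oseledets_limit A E)
  (E_eig : ordered_eigenvalues E lam)
  (growth : vector_growth_rates A (lyapunov_exponent lam))
  (d0_card : #|[pred j : 'I_d | (0 <= lyapunov_exponent lam j)%E]| = d0)
  (d0_lt : (d0 < d)%N) :
  forall eps : R, 0 < eps ->
  exists2 n1 : nat, (0 < n1)%N & forall n, (n1 <= n)%N ->
    (d - d0 <= \dim (alpha_eigenspace eps (kalman_forecast A H Q Delta0 n)))%N /\
    (d - d0 <= \dim (alpha_eigenspace eps (kalman_analysis A H Q Delta0 n)))%N.
Proof.
move=> eps eps0.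
have [Delta0_sym Delta0_pos] := Delta0_gt0.
have Delta0_psd : possemidef Delta0.
  split=> // u; have [->|/Delta0_pos/ltW//] := eqVneq u 0.
  by rewrite mulmx0 mxE.
have [W WB WE] := E_lim.
have Esym : E^T = E.
  apply/matrixP => i j; rewrite mxE; apply/eqP/negPn/negP => Eij.
  (* A symmetric [W N.+1] cannot be closer than half the gap to both entries. *)
  have h0 : 0 < `|E j i - E i j| / 2 by rewrite divr_gt0// normr_gt0 subr_eq0.
  have [N _ /(_ N.+1 (leqnSn _))[_ WN]] := cvg_ball WE h0.
  have [[/matrixP/(_ i j) + _] _] := WB N.+1 isT; rewrite mxE => Wij.
  have := ler_distD (W N.+1 i j) (E j i) (E i j).
  have := WN i j; have := WN j i; rewrite /ball/= Wij (distrC (W _ _ _)).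
  by move=> H1 H2; lra.
have [P0 [D ED]] := real_spectral Esym.
have [a [a0 a1 aD]] := low_gap D.
(* An exponent is non-negative exactly when [1 <= lam i], so the complement counts the eigenvalues
   below 1, zero included. *)
have kE : #|[pred i | D 0 i < a]| = (d - d0)%N.
  rewrite aD (ordered_eigenvalues_count 1 ED E_eig) -d0_card.
  rewrite -[X in (X - _)%N]card_ord.
  rewrite -(cardC [pred j | (0 <= lyapunov_exponent lam j)%E]).
  rewrite addKn; apply: eq_card => i.
  by rewrite !inE /lyapunov_exponent lne_ge0 lee_fin -ltNge.
pose b := (1 + a) / 2.
have [ab b1] : a < b /\ b < 1 by rewrite /b; split; lra.
have d_gt0 : 0 < d%:R :> R by rewrite ltr0n (leq_ltn_trans _ d0_lt).
(* Chosen so that [a + e * d%:R] is the midpoint of [a] and [b], as [low_count_perturb] needs a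
   value below [b]. *)
pose e := (b - a) / 2 / d%:R.
have e0 : 0 < e by rewrite !divr_gt0// subr_gt0.
(* The sum of all moduli dominates each entry, which is what [qform_entries_le] asks for. *)
pose c := (\sum_i \sum_j `|Delta0 i j|) * d%:R.
have c0 : 0 <= c.
  by rewrite mulr_ge0// sumr_ge0// => i _; rewrite sumr_ge0.
have Dc v : qform Delta0 v <= c * qform 1%:M v.
  apply: qform_entries_le => i j.
  rewrite (bigD1 i)//= (bigD1 j)//= -addrA lerDl addr_ge0//.
    by rewrite sumr_ge0.
  by rewrite sumr_ge0// => k _; rewrite sumr_ge0.
have Wnear : \forall n \near \oo, ball E e (W n) by exact: cvg_ball WE _ e0.
have b20 : `|b ^+ 2| < 1.
  by rewrite ger0_norm ?sqr_ge0// expr_lt1//; rewrite /b; lra.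
have cb : c * (b ^+ 2) ^+ n @[n --> \oo] --> c * 0.
  by apply: cvgMr; exact: cvg_expr.
have Cnear : \forall n \near \oo, c * (b ^+ 2) ^+ n < eps.
  by apply: (cvgr_lt _ cb); rewrite mulr0.
have [N _ NP] : \forall n \near \oo, ball E e (W n) /\ c * (b ^+ 2) ^+ n < eps.
  exact: filterI Wnear Cnear.
(* The successor ensures [1 <= n], where [W n] is a genuine root. *)
exists N.+1 => // n Nn.
have n1 : (1 <= n)%N by exact: leq_trans Nn.
have [[_ Wn] cn] := NP n (ltnW Nn).
have [Wpsd WnB] := WB n n1.
have [P' [D' WD]] := real_spectral Wpsd.1.
have [PP' _] := WD.
have kW : (d - d0 <= #|[pred i | (D' 0 i < b)%R]|)%N.
  rewrite -kE; apply: (low_count_perturb (e := e) ED WD).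
    by move=> i j; have := Wn i j; rewrite /ball/= distrC !mxE => /ltW.
  by rewrite /e divfK ?gt_eqF//; lra.
set B := propagator A 0 n in WnB.
have Bu : B \in unitmx by exact: propagator_unit.
pose M := B *m low_eigenbasis P' D' b.
have MS (S : 'M[R]_d) :
    (forall v, qform S v <= qform (B *m Delta0 *m B^T) v) ->
    forall u, u != 0 -> qform S (M *m u) < eps * qform 1%:M (M *m u).
  move=> SB u u0; apply: (le_lt_trans (SB _)).
  have -> : M *m u = B *m (low_eigenbasis P' D' b *m u) by rewrite mulmxA.
  apply: le_lt_trans (low_eigenspace_growth WD Wpsd WnB c0 Dc u) _.
  (* Strictness needs [M *m u] nonzero: [B] is invertible and the low eigenbasis has orthonormal
     columns. *)
  rewrite ltr_pM2r ?exprM//; apply: qform1_gt0.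
  apply: contra_neq u0 => /(congr1 (mulmx (invmx B))).
  rewrite mulKmx// mulmx0 => /(congr1 (mulmx (low_eigenbasis P' D' b)^T)).
  by rewrite mulmxA low_eigenbasis_ortho// mul1mx mulmx0.
have [Fpsd Fle] := kalman_forecast_le A H Q_cov Q_unit n1 Delta0_psd.
have [Apsd Ale] := kalman_le A H Q_cov Q_unit n Delta0_psd.
split; apply: (leq_trans kW).
  exact: alpha_eigenspace_rayleigh Fpsd (MS _ Fle).
exact: alpha_eigenspace_rayleigh Apsd (MS _ Ale).
Qed.
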